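(* Suppose Assumptions 1-4 listed in the context hold. Let $(x_t),(\lambda_t)$ be generated by Algorithm 2 (described in the context) with $\alpha=\sqrt{\frac{T}{\tau+1}}$ and $\sigma=\sqrt{\frac{\tau+1}{T}}$, and assume $T$ is large enough such that $T>(\tau+1)p\kappa_g^2$. Then, for $i=1,\ldots,p$, $$\begin{aligned}\sum_{t=0}^{T-1}g^{(i)}_t(x_t)\le{}&[\kappa_2+2\sqrt{p}\,\kappa_g^2(\nu_g+\kappa_2)(\tau+1)]+(\kappa_0+\kappa_1)(\tau+1)^{-\frac12}\sqrt{T}\\&+[2\kappa_3+2\kappa_g\kappa_f+2\sqrt{p}\,\kappa_g^2(\kappa_0+\kappa_1)](\tau+1)^{\frac12}\sqrt{T}+4\sqrt{p}\,\kappa_g^2\kappa_3(\tau+1)^{\frac32}\sqrt{T},\end{aligned}$$ where $$\kappa_0=\frac{4\kappa_fD}{\varepsilon_0},\quad \kappa_1=\frac{D^2}{\varepsilon_0},\quad \kappa_2=\frac{\nu_g^2}{\varepsilon_0}-\nu_g,\quad \kappa_3=2\nu_g+\frac{\varepsilon_0}{2}+\frac{8\nu_g^2}{\varepsilon_0}\log\frac{32\nu_g^2}{\varepsilon_0^2}.$$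
   Context: Setting. $\mathcal X$ is a finite-dimensional real Hilbert space with inner product $\langle\cdot,\cdot\rangle$ and induced norm $\|\cdot\|$; $\mathcal C\subseteq\mathcal X$ is a closed convex set. $T\ge1$, $p\ge 1$ and $\tau\ge0$ (the feedback delay) are integers with $T>\tau$, and $[T]=\{0,1,\ldots,T-1\}$. For each $t\in[T]$ there are a loss function $f_t:\mathcal C\to\mathbb R$ and a constraint function $g_t=(g_t^{(1)},\ldots,g_t^{(p)}):\mathcal C\to\mathbb R^p$. On $\mathbb R^p$, $\|\cdot\|$ is the Euclidean norm, and $[a]_+=\max\{a,0\}$ is applied componentwise. $\partial h(x)$ denotes the subdifferential (set of subgradients) of a convex function $h$ at $x$. Models. For each $t\in[T]$ and each reference point $x\in\mathcal C$ there are given convex functions $F_{t,x}$ and $G^{(i)}_{t,x}$, $i=1,\ldots,p$, real-valued on $\mathcal C$ (models of $f_t$ and $g_t^{(i)}$ at $x$); write $G_{t,x}=(G^{(1)}_{t,x},\ldots,G^{(p)}_{t,x})$. Assumption 1: the set $\mathcal C$ is bounded; there is a constant $D>0$ with $\|x-y\|\le D$ for all $x,y\in\mathcal C$. Assumption 2: every $f_t$ and $g_t^{(i)}$ is continuous and convex with bounded subgradients: there are constants $\kappa_f,\kappa_g>0$ (independent of $t,i$) such that $\|u_t\|\le\kappa_f$ and $\|v_t^{(i)}\|\le\kappa_g$ for all $x\in\mathcal C$, $u_t\in\partial f_t(x)$, $v_t^{(i)}\in\partial g_t^{(i)}(x)$. Assumption 3 (Slater): there are a constant $\varepsilon_0>0$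 and $\widehat x\in\mathcal C$ (independent of $t$) with $g_t^{(i)}(\widehat x)\le-\varepsilon_0$ for $i=1,\ldots,p$ and all $t\in[T]$. Assumption 4: for all $t\in[T]$ and $x\in\mathcal C$: (i) $F_{t,x}(y)\le f_t(y)$ for all $y\in\mathcal C$, and $F_{t,x}(x)=f_t(x)$; (ii) for each $i=1,\ldots,p$, $G^{(i)}_{t,x}(y)\le g_t^{(i)}(y)$ for all $y\in\mathcal C$, and $G^{(i)}_{t,x}(x)=g_t^{(i)}(x)$; (iii) there is a constant $\nu_g>0$ (independent of $t,x$) with $\|G_{t,x}(y)\|\le\nu_g$ for all $y\in\mathcal C$. Algorithm 2 (model-based augmented Lagrangian method with delay $\tau$, parameters $\sigma,\alpha>0$). Choose any $x_0\in\mathcal C$, set $x_1=\cdots=x_\tau=x_0$ and $\lambda_0=\lambda_1=\cdots=\lambda_\tau=0\in\mathbb R^p$. With $$\mathcal L_{t,\sigma}(x,\lambda)=F_{t,x_t}(x)+\frac1{2\sigma}\left[\|[\lambda+\sigma G_{t,x_t}(x)]_+\|^2-\|\lambda\|^2\right],$$ for $t=\tau,\tau+1,\ldots,\tau+T-1$ set $$x_{t+1}=\operatorname{argmin}_{x\in\mathcal C}\left\{\mathcal L_{t-\tau,\sigma}(x,\lambda_t)+\frac{\alpha}{2}\|x-x_{t-\tau}\|^2\right\},\qquad \lambda_{t+1}=[\lambda_t+\sigma G_{t-\tau,x_{t-\tau}}(x_{t+1})]_+.$$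
   Formalization: With all functions defined only on C, bounded subgradients are impossible when dim X > 0; so losses, constraints and models are taken on a convex set U containing C (U = C or U open), with convexity, continuity of losses and constraints, subgradients and the model inequalities F ≤ f, G ≤ g all on U. *)

(* Defs.v *)
From HB Require Import structures.
From mathcomp Require Import all_boot all_order all_algebra.
From mathcomp Require Import all_classical all_reals all_analysis.

Set Implicit Arguments.
Unset Strict Implicit.
Unset Printing Implicit Defensive.

Import Order.TTheory GRing.Theory Num.Theory.
Import numFieldNormedType.Exports.

Local Open Scope classical_set_scope.
Local Open Scope ring_scope.

#[short(type="finNormedModType")]
HB.structure Definition FinNormedModule (R : numFieldType) :=
  {X of NormedModule R X & Vector R X}.

(* A finite-dimensional real Hilbert space is a [finNormedModType] whose norm
   is induced by a positive definite symmetric form (completeness being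
   automatic in finite dimension). *)
Definition induces_norm (R : realType) (X : finNormedModType R)
    (dot : {dot X for idfun}) : Prop :=
  forall x : X, `|x| = Num.sqrt (dot x x).

(* The library norm on ['rV_p] is the sup norm. *)
Definition norm2 (R : realType) (p : nat) (v : 'rV[R]_p) : R :=
  Num.sqrt (\sum_(i < p) v 0 i ^+ 2).

Definition pospart (R : realType) (p : nat) (v : 'rV[R]_p) : 'rV[R]_p :=
  map_mx (fun a : R => Num.max a 0) v.

(* Subgradients at [x] of the function [h], real-valued on the domain [U]
   (that is, [h] is [+oo] outside [U]). *)
Definition subdifferential (R : realType) (X : finNormedModType R)
    (dot : {dot X for idfun}) (U : set X) (h : X -> R) (x : X) : set X :=
  [set u | forall y, U y -> h x + dot u (y - x) <= h y].

Definition is_argmin (R : realType) (X : Type) (C : set X) (h : X -> R)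
    (z : X) : Prop :=
  C z /\ forall y, C y -> h z <= h y.

(* [U] is the convex set on which the losses, the constraints and their models
   are convex functions and relative to which their subgradients are taken.
   The choice [U = C] is allowed. With that choice, however, subdifferentials
   contain normal cones: if [e != 0] and [x] minimises
   [h y + M * dot e y] over the compact set [C], then [- (M *: e)] is a
   subgradient of [h] at [x], for every [M]; so uniformly bounded subgradients
   force a zero-dimensional space. The other choice, an open [U] (for example
   the whole space), is the one for which the subgradient bounds say that the
   functions are Lipschitz on [C]. *)
Definition is_domain (R : realType) (X : finNormedModType R)
    (C U : set X) : Prop :=
  [/\ C `<=` U, @convex_set R X U & U = C \/ open U].

Definition assumption1 (R : realType) (X : finNormedModType R)
    (C : set X) (D : R) : Prop :=
  0 < D /\ forall x y, C x -> C y -> `|x - y| <= D.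

Definition assumption2 (R : realType) (X : finNormedModType R)
    (dot : {dot X for idfun}) (C U : set X) (T p : nat)
    (f : nat -> X -> R) (g : nat -> X -> 'rV[R]_p) (kf kg : R) : Prop :=
  [/\ 0 < kf, 0 < kg,
      forall t, (t < T)%N ->
        [/\ {within U, continuous (f t)}, @convex_function R X U (f t) &
            forall x u, C x -> subdifferential dot U (f t) x u -> `|u| <= kf]
    & forall t (i : 'I_p), (t < T)%N ->
        let gti := fun y => g t y 0 i in
        [/\ {within U, continuous gti}, @convex_function R X U gti &
            forall x v, C x -> subdifferential dot U gti x v -> `|v| <= kg]].

Definition assumption3 (R : realType) (X : finNormedModType R)
    (C : set X) (T p : nat) (g : nat -> X -> 'rV[R]_p) (eps0 : R) : Prop :=
  0 < eps0 /\
  exists2 xhat, C xhat &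
    forall t (i : 'I_p), (t < T)%N -> g t xhat 0 i <= - eps0.

Definition are_models (R : realType) (X : finNormedModType R)
    (C U : set X) (T p : nat)
    (F : nat -> X -> X -> R) (G : nat -> X -> X -> 'rV[R]_p) : Prop :=
  forall t x, (t < T)%N -> C x ->
    @convex_function R X U (F t x) /\
    forall i : 'I_p, @convex_function R X U (fun y => G t x y 0 i).

(* Minorisation is required on all of [U]. For an open [U], minorisation on [C]
   alone would not bound the slope of a model at a boundary point of [C]. *)
Definition assumption4 (R : realType) (X : finNormedModType R)
    (C U : set X) (T p : nat)
    (f : nat -> X -> R) (g : nat -> X -> 'rV[R]_p)
    (F : nat -> X -> X -> R) (G : nat -> X -> X -> 'rV[R]_p)
    (nug : R) : Prop :=
  0 < nug /\
  forall t x, (t < T)%N -> C x ->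
    [/\ (forall y, U y -> F t x y <= f t y) /\ F t x x = f t x,
        forall i : 'I_p,
          (forall y, U y -> G t x y 0 i <= g t y 0 i) /\
          G t x x 0 i = g t x 0 i
      & forall y, C y -> norm2 (G t x y) <= nug].

(* [aug_lagrangian F G s xt sigma] is the augmented Lagrangian built from the
   models of round [s] at the reference point [xt]. *)
Definition aug_lagrangian (R : realType) (X : finNormedModType R) (p : nat)
    (F : nat -> X -> X -> R) (G : nat -> X -> X -> 'rV[R]_p)
    (s : nat) (xt : X) (sigma : R) (y : X) (lam : 'rV[R]_p) : R :=
  F s xt y + (2 * sigma)^-1 *
    (norm2 (pospart (lam + sigma *: G s xt y)) ^+ 2 - norm2 lam ^+ 2).

Definition algorithm2 (R : realType) (X : finNormedModType R)
    (C : set X) (T p tau : nat)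
    (F : nat -> X -> X -> R) (G : nat -> X -> X -> 'rV[R]_p)
    (sigma alpha : R) (x : nat -> X) (lam : nat -> 'rV[R]_p) : Prop :=
  [/\ C (x 0%N),
      forall t, (t <= tau)%N -> x t = x 0%N,
      forall t, (t <= tau)%N -> lam t = 0
    & forall t, (tau <= t < tau + T)%N ->
        let s := (t - tau)%N in
        is_argmin C
          (fun y => aug_lagrangian F G s (x s) sigma y (lam t)
                    + alpha / 2 * `|y - x s| ^+ 2)
          (x t.+1) /\
        lam t.+1 = pospart (lam t + sigma *: G s (x s) (x t.+1))].

(* Main.v *)
Require Import Defs.
From HB Require Import structures.
From mathcomp Require Import all_boot all_order all_algebra.
From mathcomp Require Import all_classical all_reals all_analysis.
From mathcomp Require Import ring lra zify.
Import Order.TTheory GRing.Theory Num.Theory.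
Import numFieldNormedType.Exports.
Local Open Scope classical_set_scope.
Local Open Scope ring_scope.

(** Write [n_t] for the norm of the multiplier [lam_t]. Comparing the minimiser
    [x_{t+1}] of the strongly convex subproblem with the Slater point [xh] gives
    [n_{t+1}^2 <= n_t^2 - 2 sigma eps0 n_t + O(sigma)
       + `|xh - x_{t-tau}|^2 - `|xh - x_{t+1}|^2],
    so that [n_t^2 + \sum_(j <= tau) `|xh - x_{t-j}|^2] decreases as soon as
    [n_t] exceeds a threshold, and the multipliers stay bounded. Comparing
    [x_{t+1}] with [x_{t-tau}] instead bounds [`|x_{t+1} - x_{t-tau}|] by
    [O(sigma)]. Since [lam_{t+1} >= lam_t + sigma G(x_{t+1})], the sum of the
    [G(x_{t+1})] telescopes, and [g(x_{t-tau}) = G(x_{t-tau})] exceeds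
    [G(x_{t+1})] by at most [kg `|x_{t+1} - x_{t-tau}|].

    The last step needs a subgradient of the model, which exists when [U] is
    open. When [U = C], bounded subgradients force [C] to be a single point. *)

(** * Euclidean geometry of [X]: Cauchy-Schwarz, representation of linear forms, compactness *)

Section InnerProduct.
Set Implicit Arguments.
Unset Strict Implicit.
Context {R : realType} {X : finNormedModType R}.
Variable dot : {dot X for idfun}.
Implicit Types (u v w : X) (a : R).

Lemma dotC u v : dot u v = dot v u.
Proof. by rewrite hermC expr0 mul1r. Qed.

Lemma dotDr u v w : dot u (v + w) = dot u v + dot u w.
Proof. exact: linearDr. Qed.

Lemma dotZr a u v : dot u (a *: v) = a * dot u v.
Proof. exact: linearZr_LR. Qed.

Lemma dotDl u v w : dot (v + w) u = dot v u + dot w u.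
Proof. by rewrite dotC dotDr !(dotC u). Qed.

Lemma dotZl a u v : dot (a *: v) u = a * dot v u.
Proof. by rewrite dotC dotZr dotC. Qed.

Lemma dot_sumr u (I : finType) (F : I -> X) :
  dot u (\sum_i F i) = \sum_i dot u (F i).
Proof. exact: linear_sumr. Qed.

Hypothesis hdot : induces_norm dot.

Lemma sqr_norm_dot u : `|u| ^+ 2 = dot u u.
Proof.
rewrite hdot sqr_sqrtr//; have [->|u0] := eqVneq u 0; first by rewrite linear0r.
by rewrite ltW// neq0_dnorm_gt0.
Qed.

Lemma sqr_normD u v : `|u + v| ^+ 2 = `|u| ^+ 2 + 2 * dot u v + `|v| ^+ 2.
Proof. by rewrite !sqr_norm_dot dotDr !dotDl (dotC v u); ring. Qed.

(** Expanding the nonnegative square of the norm of [|v| u - |u| v] leaves twice [|u| |v|] times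
    [|u| |v| - dot u v]. *)
Lemma ler_dot_norm u v : dot u v <= `|u| * `|v|.
Proof.
have [->|u0] := eqVneq u 0; first by rewrite linear0l normr0 mul0r.
have [->|v0] := eqVneq v 0; first by rewrite linear0r normr0 mulr0.
have uv0 : 0 < `|u| * `|v| by rewrite mulr_gt0 ?normr_gt0.
have := sqr_normD (`|v| *: u) (- `|u| *: v).
rewrite !normrZ normrN !normr_id dotZr dotZl => h.
have := sqr_ge0 (Num.norm (`|v| *: u + - `|u| *: v)); rewrite {}h => h.
rewrite -subr_ge0 -(pmulr_rge0 _ uv0); nra.
Qed.

Lemma ler_norm_dot u v : `|dot u v| <= `|u| * `|v|.
Proof.
rewrite ler_norml ler_dot_norm andbT lerNl -mulN1r -dotZl.
by rewrite (le_trans (ler_dot_norm _ _))// normrZ normrN1 mul1r.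
Qed.

Lemma dot_continuous u : continuous (dot u).
Proof.
apply/bounded_linear_continuous/linear_boundedP; near=> r => v.
by rewrite (le_trans (ler_norm_dot _ _))// ler_wpM2r//.
Unshelve. all: by end_near. Qed.


Local Notation n := (\dim {:X}).
Local Notation e := (vbasis {:X}).

(* The Gram matrix of a basis is invertible. *)
Lemma dot_representation (c : 'I_n -> R) :
  exists u, forall v, dot u v = \sum_j c j * coord e j v.
Proof.
pose A : 'M[R]_n := \matrix_(i, j) dot e`_i e`_j.
have dotA (w : 'rV_n) v :
    dot (\sum_i w 0 i *: e`_i) v = \sum_j (w *m A) 0 j * coord e j v.
  rewrite {1}(coord_vbasis (memvf v)) dot_sumr; apply: eq_bigr => j _.
  rewrite dotZr mulrC; congr (_ * _); rewrite dotC dot_sumr !mxE.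
  by apply: eq_bigr => i _; rewrite dotZr mxE dotC.
have Aunit : A \in unitmx.
  (* If [w] is in the left kernel, the vector with coordinates [w] is orthogonal to every vector,
     itself included, hence zero. *)
  rewrite -row_free_unit; apply/inj_row_free => w wA0.
  have w0 : \sum_i w 0 i *: e`_i = 0.
    apply/eqP/negPn/negP => /(neq0_dnorm_gt0 (s := dot)).
    by rewrite dotA wA0 big1 ?ltxx// => j _; rewrite mxE mul0r.
  apply/rowP => j; rewrite mxE.
  by rewrite -(coord_sum_free (w 0) j (basis_free (vbasisP _))) w0 linear0.
exists (\sum_i (\row_j c j *m invmx A) 0 i *: e`_i) => v.
by rewrite dotA mulmxKV//; apply: eq_bigr => j _; rewrite mxE.
Qed.

Lemma bounded_coord j :
  exists2 M, 0 <= M & forall v, `|coord e j v| <= M * `|v|.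
Proof.
have [u uE] := dot_representation (fun i => (i == j)%:R).
exists `|u| => // v; suff -> : coord e j v = dot u v by exact: ler_norm_dot.
rewrite uE (bigD1 j)//= eqxx mul1r big1 ?addr0// => i.
by move=> /negbTE ->; rewrite mul0r.
Qed.

(** Coordinates are bounded on [C], so [C] is a closed subset of the continuous image of a product
    of segments. *)
Lemma norm_bounded_closed_compact (C : set X) (B : R) :
  (forall v, C v -> `|v| <= B) -> closed C -> compact C.
Proof.
move=> CB cC.
pose r2x (w : 'rV[R]_n) : X := \sum_j w 0 j *: e`_j.
have r2x_cont : continuous r2x.
  rewrite /r2x; elim: (index_enum _) => [|j s ih].
    rewrite (_ : (fun _ => _) = cst 0); first exact: cst_continuous.
    by apply/funext => w; rewrite big_nil.
  rewrite (_ : (fun _ => _) =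
    (fun w : 'rV[R]_n => w 0 j *: e`_j + \sum_(i <- s) w 0 i *: e`_i));
    last first.
    by apply/funext => w; rewrite big_cons.
  move=> w; apply: (@continuousD R X 'rV[R]_n); last exact: ih.
  by apply: (@continuousZr_tmp R X 'rV[R]_n); exact: coord_continuous.
have /choice[M Mcoord] j : exists M, forall v, C v -> coord e j v \in `[- M, M].
  have [M M0 HM] := bounded_coord j; exists (M * B) => v Cv.
  by rewrite in_itv/= -ler_norml (le_trans (HM v))// ler_wpM2l// CB.
apply: (subclosed_compact cC (continuous_compact (continuous_subspaceT r2x_cont)
  (@rV_compact _ _ (fun j => `[- M j, M j]%classic)
    (fun=> @segment_compact _ _ _)))).
move=> v Cv; exists (\row_j coord e j v) => [j|].
  by rewrite /= mxE Mcoord.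
rewrite [RHS](coord_vbasis (memvf v)) /r2x.
by apply: eq_bigr => j _; rewrite mxE.
Qed.

End InnerProduct.

(** * Convexity restated with real weights and explicit bounds *)

Section Convexity.
Set Implicit Arguments.
Unset Strict Implicit.
Context {R : realType} {X : lmodType R}.
Implicit Types (U : set X) (h : X -> R) (x y : X) (t : R).

Lemma convex_setP U : @convex_set R X U -> forall x y t, U x -> U y ->
  0 <= t -> t <= 1 -> U (t *: x + (1 - t) *: y).
Proof.
move=> cU x y t Ux Uy t0 t1.
by have /set_mem := cU x y (Itv01 t0 t1) (mem_set Ux) (mem_set Uy).
Qed.

Lemma convex_functionP U h : @convex_function R X U h <->
  forall x y t, U x -> U y -> 0 <= t -> t <= 1 ->
  h (t *: x + (1 - t) *: y) <= t * h x + (1 - t) * h y.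
Proof.
split=> [ch x y t Ux Uy t0 t1|hP t x y /set_mem Ux /set_mem Uy].
  exact: ch (Itv01 t0 t1) _ _ (mem_set Ux) (mem_set Uy).
exact: hP.
Qed.

Lemma convex_functionS (C U : set X) h : C `<=` U ->
  @convex_function R X U h -> @convex_function R X C h.
Proof.
move=> CU hU t a b /set_mem Ca /set_mem Cb.
by apply: hU; apply: mem_set; exact: CU.
Qed.

End Convexity.

(** * Existence of subgradients, Lipschitz bounds for models, and proximal optimality *)

Section Subgradients.
Set Implicit Arguments.
Unset Strict Implicit.
Context {R : realType} {X : finNormedModType R}.
Variable dot : {dot X for idfun}.
Hypothesis hdot : induces_norm dot.
Implicit Types (U C : set X) (h f : X -> R) (x y : X).

Lemma open_line_segment U x v : open U -> U x ->
  exists2 s, 0 < s & U (x + s *: v) /\ U (x - s *: v).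
Proof.
move=> oU Ux; have /nbhs_ballP[r /= r0 rU] : nbhs x U by exact: open_nbhs_nbhs.
(* The added 1 keeps the step length meaningful when [v = 0]. *)
have v0 : 0 < `|v| + 1 by rewrite ltr_wpDl.
have sv : r / (`|v| + 1) * `|v| < r.
  by rewrite -mulrA gtr_pMr// mulrC ltr_pdivrMr// mul1r ltrDl.
have s0 : 0 < r / (`|v| + 1) by rewrite divr_gt0.
exists (r / (`|v| + 1)) => //; split; apply: rU; rewrite -ball_normE/=.
  by rewrite opprD addrA subrr sub0r normrN normrZ gtr0_norm.
by rewrite opprB addrC subrK normrZ gtr0_norm.
Qed.

(* Hahn-Banach, one coordinate at a time. *)
Lemma subdifferential_nonempty U h x : open U -> @convex_set R X U ->
  @convex_function R X U h -> U x -> exists u, subdifferential dot U h x u.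
Proof.
move=> oU cU ch Ux.
pose e := vbasis {:X}.
pose phi (c : 'I_(\dim {:X}) -> R) (v : X) := \sum_j c j * coord e j v.
(* [W k] is the span of the first [k] basis vectors. By induction on [k], an affine minorant of [h],
   exact at [x], is extended from [x + W k] to [x + W k.+1]. *)
pose W k : set X :=
  [set v | forall j : 'I_(\dim {:X}), (k <= j)%N -> coord e j v = 0].
suff H k : (k <= \dim {:X})%N ->
    exists c, forall v, W k v -> U (x + v) -> h x + phi c v <= h (x + v).
  have [c cP] := H _ (leqnn _).
  have [u uE] := dot_representation dot c; exists u => y Uy.
  rewrite uE -/(phi c (y - x)); have := cP (y - x); rewrite subrKC.
  by apply=> // j; rewrite leqNgt ltn_ord.
have phiD c v w : phi c (v + w) = phi c v + phi c w.
  by rewrite /phi -big_split; apply: eq_bigr => j _; rewrite linearD mulrDr.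
have phiZ c a v : phi c (a *: v) = a * phi c v.
  by rewrite /phi mulr_sumr; apply: eq_bigr => j _; rewrite linearZ/= mulrCA.
elim: k => [_|k IH kn].
  exists (fun=> 0) => v Wv _; suff -> : v = 0.
    by rewrite addr0 /phi big1 ?addr0// => j _; rewrite mul0r.
  by rewrite (coord_vbasis (memvf v)) big1// => j _; rewrite Wv// scale0r.
have [c cP] := IH (ltnW kn); pose i := Ordinal kn.
have ei j : coord e j e`_i = (j == i)%:R.
  by rewrite (coord_free _ _ (basis_free (vbasisP _))) eq_sym.
have WD v w : W k v -> W k w -> W k (v + w).
  by move=> Wv Ww j kj; rewrite linearD/= Wv// Ww// addr0.
have WZ a v : W k v -> W k (a *: v).
  by move=> Wv j kj; rewrite linearZ/= Wv// mulr0.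
have W0 : W k 0 by move=> j _; rewrite linear0.
(* If the new coefficient is [a], minorisation at [x + v - s e_i] says exactly that [a] is at least
   [slope v s]. So [L] collects the lower bounds on [a]. *)
pose slope v s := (h x + phi c v - h (x + v - s *: e`_i)) / s.
pose L : set R := [set a | exists v s,
  [/\ W k v, 0 < s, U (x + v - s *: e`_i) & a = slope v s]].
have L_ub v s : W k v -> 0 < s -> U (x + v + s *: e`_i) ->
    ubound L ((h (x + v + s *: e`_i) - h x - phi c v) / s).
  move=> Wv s0 Uv _ [w [r [Ww r0 Uw ->]]].
  have rs0 : 0 < r + s by rewrite addr_gt0.
  (* With this weight the components along [e_i] cancel, and the convex combination lands in
     [x + W k], where the induction hypothesis applies. *)
  pose l := s / (r + s).
  have l0 : 0 <= l by rewrite divr_ge0 ?ltW.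
  have l1 : l <= 1 by rewrite ler_pdivrMr// mul1r lerDr ltW.
  have E : l *: (x + w - r *: e`_i) + (1 - l) *: (x + v + s *: e`_i) =
      x + (l *: w + (1 - l) *: v).
    have lr : (1 - l) * s = l * r by rewrite /l; field; rewrite gt_eqF.
    rewrite -!addrA !(scalerDr _ x) addrACA -scalerDl subrKC scale1r.
    congr (x + _); rewrite !scalerDr scalerN !scalerA lr addrACA.
    by rewrite addNr addr0.
  have := (convex_functionP _ _).1 ch _ _ _ Uw Uv l0 l1.
  have := convex_setP cU Uw Uv l0 l1; rewrite E => /cP.
  move=> /(_ (WD _ _ (WZ _ _ Ww) (WZ _ _ Wv))).
  rewrite phiD !phiZ; move=> /le_trans/[apply] H.
  rewrite /slope ler_pdivlMr// [leLHS]mulrAC ler_pdivrMr//; move: H.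
  set hx := h x; set hy := h _; set hy' := h _.
  set pw := phi _ _; set pv := phi _ _.
  move=> H; have {H} := ler_wpM2l (ltW rs0) H.
  have -> : (r + s) * (hx + (l * pw + (1 - l) * pv)) =
      (r + s) * hx + s * pw + r * pv.
    by rewrite /l; field; rewrite gt_eqF.
  have -> : (r + s) * (l * hy + (1 - l) * hy') = s * hy + r * hy'.
    by rewrite /l; field; rewrite gt_eqF.
  nra.
(* Openness gives room on both sides of [x]: one side makes [L] nonempty, the other bounds it
   above. *)
have [s1 s10 [Us1 Us1']] := open_line_segment e`_i oU Ux.
have L0 : L !=set0.
  by exists (slope 0 s1), 0, s1; split => //; rewrite addr0.
have Lub : has_ubound L.
  exists ((h (x + 0 + s1 *: e`_i) - h x - phi c 0) / s1).
  by apply: L_ub => //; rewrite addr0.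
pose a := sup L.
exists (fun j => if j == i then a else c j) => v Wv Uv.
set c' := fun _ => _.
pose s := coord e i v; pose w := v - s *: e`_i.
have vE : v = w + s *: e`_i by rewrite subrK.
have Ww : W k w.
  move=> j kj; rewrite linearB linearZ/= ei.
  have [->|ji] := eqVneq j i; first by rewrite mulr1 subrr.
  rewrite mulr0 subr0 Wv// ltn_neqAle kj andbT.
  by apply: contra_neq ji => kj'; apply: val_inj.
have -> : phi c' v = phi c w + s * a.
  rewrite {1}vE phiD phiZ; congr (_ + _ * _).
    apply: eq_bigr => j _; rewrite /c'; have [->|//] := eqVneq j i.
    by rewrite (Ww i)// !mulr0.
  rewrite /phi (bigD1 i)//= big1 => [|j ji]; rewrite ei.
    by rewrite /c' eqxx mulr1 addr0.
  by rewrite (negbTE ji) mulr0.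
rewrite vE addrA in Uv *.
(* For [s < 0], [a] is an upper bound of [L]; for [s > 0], it is the least one and [L_ub] gives an
   upper bound; for [s = 0], the induction hypothesis applies. *)
have [s0|s0|s0] := ltgtP s 0.
- have : slope w (- s) <= a.
    apply: ub_le_sup => //; exists w, (- s); split => //.
      by rewrite oppr_gt0.
    by rewrite scaleNr opprK.
  rewrite /slope scaleNr opprK ler_pdivrMr ?oppr_gt0//; nra.
- have : a <= (h (x + w + s *: e`_i) - h x - phi c w) / s.
    by apply: ge_sup => //; exact: L_ub.
  rewrite ler_pdivlMr//; nra.
- rewrite s0 scale0r addr0 mul0r addr0; apply: cP => //.
  by move: Uv; rewrite s0 scale0r addr0.
Qed.

(* For [e != 0], minimising [f + dot (M e)] over the compact set [C] gives a
   subgradient [- M e] of arbitrarily large norm. *)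
Lemma bounded_subdifferential_set1 C f (B k : R) :
  closed C -> (forall x, C x -> `|x| <= B) -> {within C, continuous f} ->
  (forall x u, C x -> subdifferential dot C f x u -> `|u| <= k) ->
  forall x y, C x -> C y -> x = y.
Proof.
move=> cC CB cf fk x y Cx Cy; apply/eqP/negPn/negP; rewrite -subr_eq0 => xy0.
(* A multiple of [x - y] whose norm exceeds the supposed bound [k]. *)
pose e := ((`|k| + 1) / `|x - y|) *: (x - y).
have ne : `|e| = `|k| + 1.
  rewrite normrZ ger0_norm ?divr_ge0// ?addr_ge0// divfK//.
  by rewrite gt_eqF// normr_gt0.
have cfe : {within C, continuous (fun z => f z + dot e z)}.
  move=> z; apply: cvgD; first exact: cf.
  exact: (continuous_subspaceT (dot_continuous hdot (u := e))).
have [|z /set_mem Cz zmin] := compact_EVT_min _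
  (norm_bounded_closed_compact hdot CB cC) cfe; first by exists x.
have : `|- e| <= k.
  apply: (fk z) => // w Cw; have := zmin w (mem_set Cw).
  by rewrite -[- e]scaleN1r linearBr/= !(dotZl _ (-1)); lra.
by rewrite normrN ne leNgt ltr_pwDr// ler_norm.
Qed.

(** Since [h] lies below [f] and touches it at [x], a subgradient of [h] at [x] is one of [f], hence
    has norm at most [k]. Taking [h = f] gives the Lipschitz bound for [f] itself. *)
Lemma lower_model_lipschitz C U f h (D k : R) :
  closed C -> is_domain C U -> (forall x y, C x -> C y -> `|x - y| <= D) ->
  {within U, continuous f} ->
  (forall x u, C x -> subdifferential dot U f x u -> `|u| <= k) ->
  @convex_function R X U h -> (forall y, U y -> h y <= f y) ->
  forall x y, C x -> C y -> h x = f x -> h x <= h y + k * `|y - x|.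
Proof.
move=> cC [CU cU] UCo CD cf fk ch hf x y Cx Cy hfx.
case: UCo => [UC|oU].
  move: CU cU cf fk ch hf; rewrite UC => _ _ cf fk _ _.
  have CB z : C z -> `|z| <= D + `|x|.
    by move=> Cz; rewrite -lerBlDr (le_trans (lerB_dist _ _))// CD.
  rewrite (bounded_subdifferential_set1 cC CB cf fk Cx Cy).
  by rewrite subrr normr0 mulr0 addr0.
have [u hu] := subdifferential_nonempty oU cU ch (CU x Cx).
have uk : `|u| <= k.
  apply: (fk x) => // z Uz; rewrite -hfx (le_trans (hu z Uz))//; exact: hf.
have := hu y (CU y Cy); rewrite -lerBrDr => /le_trans; apply.
rewrite lerD2l -mulN1r -dotZl (le_trans (ler_dot_norm hdot _ _))//.
by rewrite normrZ normrN1 mul1r ler_wpM2r.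
Qed.

(* First-order optimality, tested along the segment from [z] to [y]. *)
Lemma argmin_prox C h (a : R) w z : @convex_set R X C ->
  @convex_function R X C h -> 
  is_argmin C (fun y => h y + a / 2 * `|y - w| ^+ 2) z ->
  forall y, C y -> h z + a / 2 * `|z - w| ^+ 2 + a / 2 * `|y - z| ^+ 2 <=
    h y + a / 2 * `|y - w| ^+ 2.
Proof.
move=> cC ch [Cz zmin] y Cy.
set p : R := `|y - z| ^+ 2; set q := dot (z - w) (y - z).
have E (t : R) : `|t *: y + (1 - t) *: z - w| ^+ 2 =
    `|z - w| ^+ 2 + 2 * (t * q) + t ^+ 2 * p.
  have -> : t *: y + (1 - t) *: z - w = (z - w) + t *: (y - z).
    by rewrite scalerBl scale1r scalerBr [RHS]addrAC addrCA.
  by rewrite [LHS](sqr_normD hdot) dotZr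
    normrZ exprMn real_normK ?num_real.
have yw : `|y - w| ^+ 2 = `|z - w| ^+ 2 + 2 * q + p.
  by have := E 1; rewrite subrr scale1r scale0r addr0 mul1r expr1n mul1r.
have step t : 0 < t -> t <= 1 -> 0 <= (h y - h z + a * q) + t * (a / 2 * p).
  move=> t0 t1; rewrite -(pmulr_rge0 _ t0).
  have := zmin _ (convex_setP cC Cy Cz (ltW t0) t1); rewrite E.
  have := (convex_functionP _ _).1 ch _ _ _ Cy Cz (ltW t0) t1.
  nra.
(* The limit of [step] as [t] tends to 0: the chosen [t] makes the remainder at most [eps]. *)
have limit : 0 <= h y - h z + a * q.
  apply/ler_addgt0Pr => eps eps0.
  pose c := `|a / 2 * p| + 1.
  have c0 : 0 < c by rewrite ltr_wpDl.
  pose t := Num.min 1 (eps / c).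
  have t0 : 0 < t by rewrite lt_min ltr01 divr_gt0.
  have t1 : t <= 1 by rewrite ge_min lexx.
  rewrite (le_trans (step t t0 t1))// lerD2l.
  rewrite (@le_trans _ _ (t * c))//.
    rewrite ler_wpM2l//; first exact: ltW.
    by rewrite (le_trans (ler_norm _))// lerDl.
  by rewrite -ler_pdivlMr// ge_min lexx orbT.
by rewrite yw; lra.
Qed.

End Subgradients.

(** * The Euclidean norm on rows and the positive part *)

Section EuclideanRows.
Set Implicit Arguments.
Unset Strict Implicit.
Context {R : realType} {p : nat}.
Implicit Types (v w : 'rV[R]_p).

Lemma norm2_ge0 v : 0 <= norm2 v.
Proof. exact: sqrtr_ge0. Qed.

Lemma sqr_norm2 v : norm2 v ^+ 2 = \sum_i v 0 i ^+ 2.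
Proof. by rewrite sqr_sqrtr// sumr_ge0// => i _; exact: sqr_ge0. Qed.

Lemma ler_norm2_entry v i : `|v 0 i| <= norm2 v.
Proof.
rewrite -(ler_pXn2r (n := 2))// ?nnegrE ?norm2_ge0// sqr_norm2.
rewrite real_normK ?num_real//.
by rewrite (bigD1 i)//= lerDl sumr_ge0// => j _; exact: sqr_ge0.
Qed.

Lemma ler_norm2_sum v : (forall i, 0 <= v 0 i) -> norm2 v <= \sum_i v 0 i.
Proof.
move=> v0; have S0 : 0 <= \sum_i v 0 i by exact: sumr_ge0.
rewrite -(ler_pXn2r (n := 2))// ?nnegrE ?norm2_ge0// sqr_norm2 expr2 mulr_suml.
apply: ler_sum => i _; rewrite expr2 ler_wpM2l//.
by rewrite (bigD1 i)//= lerDl sumr_ge0.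
Qed.

(** Cauchy-Schwarz against the all-ones row, obtained by summing the squares of [|v_i| - |v_j|] over
    all pairs. *)
Lemma ler_sum_norm2 v : \sum_i `|v 0 i| <= Num.sqrt p%:R * norm2 v.
Proof.
have S0 : 0 <= \sum_i `|v 0 i| by exact: sumr_ge0.
rewrite -(ler_pXn2r (n := 2))// ?nnegrE ?mulr_ge0 ?norm2_ge0 ?sqrtr_ge0//.
rewrite exprMn sqr_sqrtr// sqr_norm2.
set S := \sum_i _ in S0 *.
have : 0 <= \sum_i \sum_j (`|v 0 i| - `|v 0 j|) ^+ 2.
  by apply: sumr_ge0 => i _; apply: sumr_ge0 => j _; exact: sqr_ge0.
have E i : \sum_j (`|v 0 i| - `|v 0 j|) ^+ 2 =
    p%:R * v 0 i ^+ 2 - 2 * `|v 0 i| * S + \sum_j v 0 j ^+ 2.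
  under eq_bigr do rewrite sqrrB.
  rewrite !big_split/= sumr_const card_ord real_normK ?num_real// mulr_natl.
  congr (_ *+ _ + _ + _).
    rewrite sumrN mulr_sumr; congr (- _); apply: eq_bigr => j _; ring.
  by apply: eq_bigr => j _; rewrite real_normK ?num_real.
under eq_bigr do rewrite E.
rewrite !big_split/= sumr_const card_ord sumrN -!mulr_suml -!mulr_sumr.
rewrite -/S -mulr_natl.
nra.
Qed.

Lemma pospart_ge0 v i : 0 <= pospart v 0 i.
Proof. by rewrite mxE le_max lexx orbT. Qed.

(** The right-hand side is the squared norm of [v + s w] expanded, and a positive part only
    decreases each square. *)
Lemma norm2_add_pospart_sqr (s : R) v w :
  norm2 (pospart (v + s *: w)) ^+ 2 <=
  norm2 v ^+ 2 + 2 * s * (\sum_i v 0 i * w 0 i) + s ^+ 2 * norm2 w ^+ 2.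
Proof.
rewrite !sqr_norm2 !mulr_sumr -!big_split/=; apply: ler_sum => i _.
rewrite !mxE; have [_|_] := leP (v 0 i + s * w 0 i) 0; last by lra.
by have := sqr_ge0 (v 0 i + s * w 0 i); lra.
Qed.

End EuclideanRows.

(** * One primal-dual step: distance moved and drift of the multiplier *)

Section AugmentedLagrangianStep.
Set Implicit Arguments.
Unset Strict Implicit.
Context {R : realType} {X : finNormedModType R}.
Variables (dot : {dot X for idfun}) (C : set X) (p : nat).
Variables (F : nat -> X -> X -> R) (G : nat -> X -> X -> 'rV[R]_p) (s : nat).
Variables (sigma alpha : R) (lam : 'rV[R]_p) (w z : X).
Hypothesis hdot : induces_norm dot.
Hypothesis cC : @convex_set R X C.
Hypothesis cF : @convex_function R X C (F s w).
Hypothesis cG : forall i, @convex_function R X C (fun y => G s w y 0 i).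
Hypothesis sigma0 : 0 < sigma.
Hypothesis alpha_sigma : alpha * sigma = 1.
Hypothesis lam0 : forall i, 0 <= lam 0 i.
Hypothesis zmin : is_argmin C
  (fun y => aug_lagrangian F G s w sigma y lam + alpha / 2 * `|y - w| ^+ 2) z.

Let L y := aug_lagrangian F G s w sigma y lam.

(** Entrywise, the penalty composes the convex nondecreasing map [[a]_+ ^ 2] with a convex
    function. *)
Lemma aug_lagrangian_convex : @convex_function R X C L.
Proof.
apply/convex_functionP => x y u Cx Cy u0 u1; rewrite /L /aug_lagrangian.
have := (convex_functionP _ _).1 cF x y u Cx Cy u0 u1.
have Gxy i := (convex_functionP _ _).1 (cG i) x y u Cx Cy u0 u1.
move: Gxy; set o := _ *: x + _; set v := 1 - u => Gxy Fxy.
have v0 : 0 <= v by rewrite subr_ge0.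
have uv : u + v = 1 by rewrite subrKC.
have s20 : 0 < (2 * sigma)^-1 by rewrite invr_gt0 mulr_gt0.
suff : norm2 (pospart (lam + sigma *: G s w o)) ^+ 2 <=
  u * norm2 (pospart (lam + sigma *: G s w x)) ^+ 2 +
  v * norm2 (pospart (lam + sigma *: G s w y)) ^+ 2.
  move=> /(ler_wpM2l (ltW s20)) H.
  by move: H Fxy; rewrite /v; lra.
rewrite !sqr_norm2 !mulr_sumr -big_split/=; apply: ler_sum => i _.
rewrite !mxE; have {}Gxy := Gxy i.
set a := lam 0 i + _; set b := lam 0 i + _; set c := lam 0 i + _.
have abc : a <= u * b + v * c.
  have -> : u * b + v * c = lam 0 i * (u + v) +
    sigma * (u * G s w x 0 i + v * G s w y 0 i) by rewrite /b /c; ring.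
  by rewrite uv mulr1 lerD2l ler_wpM2l// ltW.
have mb : b <= Num.max b 0 by rewrite le_max lexx.
have mc : c <= Num.max c 0 by rewrite le_max lexx.
have mb0 : 0 <= Num.max b 0 by rewrite le_max lexx orbT.
have mc0 : 0 <= Num.max c 0 by rewrite le_max lexx orbT.
move: (Num.max b 0) (Num.max c 0) mb mc mb0 mc0 => b' c' mb mc mb0 mc0.
have : Num.max a 0 <= u * b' + v * c'.
  rewrite ge_max addr_ge0 ?mulr_ge0// andbT (le_trans abc)//.
  by rewrite lerD// ler_wpM2l.
have : 0 <= Num.max a 0 by rewrite le_max lexx orbT.
move: (Num.max a 0) => a' a'0 a'bc.
have : a' ^+ 2 <= (u * b' + v * c') ^+ 2.
  by rewrite ler_pXn2r ?nnegrE// (le_trans a'0).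
move=> /le_trans; apply; rewrite -subr_ge0.
have -> : u * b' ^+ 2 + v * c' ^+ 2 - (u * b' + v * c') ^+ 2 =
   (u + v) * (u * b' ^+ 2 + v * c' ^+ 2) - (u * b' + v * c') ^+ 2.
  by rewrite uv mul1r.
(* The gap in the convexity inequality for the square, in closed form since [u + v = 1]. *)
have -> : (u + v) * (u * b' ^+ 2 + v * c' ^+ 2) - (u * b' + v * c') ^+ 2 =
   u * v * (b' - c') ^+ 2 by ring.
by apply: mulr_ge0; [exact: mulr_ge0|exact: sqr_ge0].
Qed.

Lemma aug_lagrangian_prox y : C y ->
  L z + alpha / 2 * `|z - w| ^+ 2 + alpha / 2 * `|y - z| ^+ 2 <=
  L y + alpha / 2 * `|y - w| ^+ 2.
Proof. exact: (argmin_prox hdot cC aug_lagrangian_convex zmin). Qed.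

(** The proximal inequality at [y = w] bounds [alpha r ^ 2], where [r = |z - w|], by the decrease of
    the augmented Lagrangian from [w] to [z]. That decrease is linear in [r], so one factor [r]
    cancels. *)
Lemma step_length (kf kg nu : R) : C w -> 0 <= kf -> 0 <= kg ->
  norm2 (G s w w) <= nu ->
  F s w w <= F s w z + kf * `|z - w| ->
  (forall i, G s w w 0 i <= G s w z 0 i + kg * `|z - w|) ->
  `|z - w| <= sigma * (kf + Num.sqrt p%:R * kg * (norm2 lam + sigma * nu)).
Proof.
move=> Cw kf0 kg0 Gnu Fwz Gwz.
have := aug_lagrangian_prox Cw; rewrite subrr normr0 -(normrN (w - z)) opprB.
rewrite /L /aug_lagrangian.
set r := `|z - w| in Fwz Gwz *; have r0 : 0 <= r by rewrite /r.
have nu0 : 0 <= nu by rewrite (le_trans (norm2_ge0 _) Gnu).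
set K := Num.sqrt p%:R * (norm2 lam + sigma * nu).
have K0 : 0 <= K.
  by rewrite mulr_ge0 ?addr_ge0 ?sqrtr_ge0 ?norm2_ge0// mulr_ge0// ltW.
have : norm2 (pospart (lam + sigma *: G s w w)) ^+ 2 -
    norm2 (pospart (lam + sigma *: G s w z)) ^+ 2 <= 2 * sigma * kg * r * K.
  rewrite !sqr_norm2 -sumrB.
  apply: (@le_trans _ _
    (\sum_i 2 * sigma * kg * r * (`|lam 0 i| + sigma * `|G s w w 0 i|))).
    (* Entrywise, [a - b] is at most [sigma kg r]. In the main case [0 < b < a], the identity
       [a^2 - b^2 = 2 a (a - b) - (a - b)^2] concludes; the other sign cases are cruder. *)
    apply: ler_sum => i _; rewrite !mxE.
    have {}Gwz := ler_wpM2l (ltW sigma0) (Gwz i).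
    have l0 := lam0 i; rewrite (ger0_norm l0).
    have sG : sigma * G s w w 0 i <= sigma * `|G s w w 0 i|.
      by rewrite ler_wpM2l ?ler_norm// ltW.
    have sG0 : 0 <= sigma * `|G s w w 0 i| by rewrite mulr_ge0// ltW.
    have skr : 0 <= sigma * kg * r by rewrite !mulr_ge0// ltW.
    set a := lam 0 i + _; set b := lam 0 i + _.
    have ab : a <= b + sigma * kg * r by rewrite /a /b; nra.
    have aS : a <= lam 0 i + sigma * `|G s w w 0 i| by rewrite lerD2l.
    have [_|a0] := leP a 0.
      have : 0 <= 2 * (sigma * kg * r * (lam 0 i + sigma * `|G s w w 0 i|)).
        by rewrite !mulr_ge0 ?addr_ge0// ltW.
      have := sqr_ge0 (Num.max b 0).
      lra.
    have a0' := ltW a0; have [b0|b0] := leP b 0.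
      have : a * a <= (sigma * kg * r) * (lam 0 i + sigma * `|G s w w 0 i|).
        by apply: ler_pM => //; lra.
      have : 0 <= sigma * kg * r * (lam 0 i + sigma * `|G s w w 0 i|).
        by rewrite mulr_ge0 ?addr_ge0.
      nra.
    have [ab'|ba'] := leP a b.
      have : a ^+ 2 <= b ^+ 2 by rewrite ler_pXn2r// nnegrE ltW.
      have : 0 <= 2 * (sigma * kg * r * (lam 0 i + sigma * `|G s w w 0 i|)).
        by rewrite !mulr_ge0 ?addr_ge0// ltW.
      lra.
    have : (a - b) * a <= (sigma * kg * r) * (lam 0 i + sigma * `|G s w w 0 i|).
      by apply: ler_pM => //; lra.
    have : 0 <= (a - b) ^+ 2 by exact: sqr_ge0.
    nra.
  rewrite -mulr_sumr; apply: ler_wpM2l.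
    by rewrite !mulr_ge0// ltW.
  rewrite big_split/= -mulr_sumr /K mulrDr lerD ?ler_sum_norm2//.
  rewrite mulrCA ler_wpM2l//; first exact: ltW.
  by rewrite (le_trans (ler_sum_norm2 _))// ler_wpM2l// sqrtr_ge0.
set A := norm2 _ ^+ 2; set B := norm2 _ ^+ 2; set N := norm2 _ ^+ 2.
move=> AB prox.
have -> : kf + Num.sqrt p%:R * kg * (norm2 lam + sigma * nu) = kf + kg * K.
  by rewrite /K; ring.
have [->|rn0] := eqVneq r 0.
  apply: mulr_ge0; first exact: ltW.
  by rewrite addr_ge0// mulr_ge0.
have rgt0 : 0 < r by rewrite lt_neqAle eq_sym rn0.
rewrite -(ler_pM2l rgt0).
have s0 : sigma != 0 by rewrite gt_eqF.
have prox2 : F s w z * sigma * 2 + (B - N) + r ^+ 2 * 2 <=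
    F s w w * sigma * 2 + (A - N).
  have := ler_wpM2l (ltW (mulr_gt0 (ltr0n _ 2) sigma0)) prox.
  rewrite (_ : alpha = sigma^-1); last first.
    by apply: (mulIf s0); rewrite alpha_sigma mulVf.
  rewrite (_ : 2%:R * sigma * (_ + _ + _) =
     F s w z * sigma * 2 + (B - N) + r ^+ 2 * 2); last by field.
  rewrite (_ : 2%:R * sigma * (_ + _) = F s w w * sigma * 2 + (A - N))//.
  by field.
have := ler_wpM2l (ltW sigma0) Fwz.
nra.
Qed.

(** The proximal inequality at [y] is multiplied by [2 sigma]; as [alpha sigma = 1], the squared
    distances get coefficient 1. Expanding the penalty at [y] gives the cross term [2 sigma] times
    the sum of [lam_i G_i(y)], at most [- 2 sigma eps] times the norm of [lam], since [lam] is
    nonnegative and its entry sum dominates its norm. *)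
Lemma dual_drift (eps nu : R) y : C y -> 0 <= eps ->
  (forall i, G s w y 0 i <= - eps) -> norm2 (G s w y) <= nu ->
  norm2 (pospart (lam + sigma *: G s w z)) ^+ 2 <=
    norm2 lam ^+ 2 - 2 * sigma * eps * norm2 lam + sigma ^+ 2 * nu ^+ 2
    + 2 * sigma * (F s w y - F s w z) + (`|y - w| ^+ 2 - `|y - z| ^+ 2).
Proof.
move=> Cy eps0 Geps Gnu; have prox := aug_lagrangian_prox Cy.
have N2 := norm2_add_pospart_sqr sigma lam (G s w y).
have nu2 : norm2 (G s w y) ^+ 2 <= nu ^+ 2.
  by rewrite ler_pXn2r ?nnegrE ?(le_trans _ Gnu) ?norm2_ge0.
have lamG : \sum_i lam 0 i * G s w y 0 i <= - eps * norm2 lam.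
  rewrite (@le_trans _ _ (\sum_i - eps * lam 0 i))//.
    by apply: ler_sum => i _; rewrite mulrC ler_wpM2r.
  rewrite -mulr_sumr !mulNr lerN2 ler_wpM2l//.
  exact: ler_norm2_sum.
have s0 : sigma != 0 by rewrite gt_eqF.
move: prox; rewrite /L /aug_lagrangian.
rewrite (_ : alpha = sigma^-1); last first.
  by apply: (mulIf s0); rewrite alpha_sigma mulVf.
set A := norm2 _ ^+ 2; set B := norm2 (pospart (lam + sigma *: G s w y)) ^+ 2.
set N := norm2 lam ^+ 2; set m := `|z - w| ^+ 2.
set q := `|y - z| ^+ 2; set r := `|y - w| ^+ 2 => prox.
have {prox} : F s w z * sigma * 2 + (A - N) + m + q <=
    F s w y * sigma * 2 + (B - N) + r.
  have := ler_wpM2l (ltW (mulr_gt0 (ltr0n _ 2) sigma0)) prox.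
  rewrite (_ : 2%:R * sigma * (_ + _ + _ + _) =
     F s w z * sigma * 2 + (A - N) + m + q); last by field.
  rewrite (_ : 2%:R * sigma * (_ + _ + _) =
     F s w y * sigma * 2 + (B - N) + r)//.
  by field.
have m0 : 0 <= m by exact: sqr_ge0.
have := ler_wpM2l (ltW sigma0) lamG.
have := ler_wpM2l (sqr_ge0 sigma) nu2.
move: N2; rewrite -/N -/B; nra.
Qed.

End AugmentedLagrangianStep.

(** * Uniform bound on the multipliers *)

Section DualBound.
Set Implicit Arguments.
Unset Strict Implicit.
Context {R : realType}.

(* A Lyapunov argument: [n t ^+ 2 + S t] decreases as soon as [n t] exceeds the
   threshold [theta]. *)
Lemma drift_bounded (n S : nat -> R) (a b c theta : R) (T : nat) :
  0 <= theta -> 0 <= b -> 0 <= c -> b <= a * theta -> 0 <= a ->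
  (forall t, (t <= T)%N -> 0 <= n t) ->
  (forall t, (t <= T)%N -> 0 <= S t <= c) ->
  n 0%N = 0 ->
  (forall t, (t < T)%N ->
     n t.+1 ^+ 2 + S t.+1 <= n t ^+ 2 + S t - a * n t + b) ->
  forall t, (t <= T)%N -> n t ^+ 2 <= theta ^+ 2 + b + c.
Proof.
move=> th0 b0 c0 bth a0 n0 S0 n00 step t tT.
suff : n t ^+ 2 + S t <= theta ^+ 2 + b + c.
  by have /andP[St0 _] := S0 t tT; lra.
elim: t tT => [_|t IH tT].
  by rewrite n00; have /andP[_ +] := S0 0%N isT; have := sqr_ge0 theta; lra.
have {}IH := IH (ltnW tT); have nt0 := n0 t (ltnW tT).
have /andP[_ Stc] := S0 t (ltnW tT); have st := step t tT.
(* Above the threshold the potential does not grow; below it, the potential is at most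
   [theta ^ 2 + c] and one step adds at most [b]. *)
have [thn|nth] := leP theta (n t).
  by have := ler_wpM2l a0 thn; lra.
have : n t ^+ 2 <= theta ^+ 2 by rewrite ler_pXn2r// ltW.
by have := mulr_ge0 a0 nt0; lra.
Qed.

(** The left side is [theta ^ 2 + b + c] of the Lyapunov bound; [l] stands for the logarithmic term
    of [k3]. The products [k0 (sigma eps)] and [k1 (d eps)] are bounded by squares of means, and a
    sum of squares of nonnegative terms is at most the square of their sum. *)
Lemma dual_bound_arith (kf D eps nu sigma d l : R) :
  0 < kf -> 0 < D -> 0 < eps -> eps <= nu -> 0 < sigma -> sigma <= 1 ->
  1 <= d -> 0 <= l ->
  ((sigma * nu ^+ 2 + 4 * kf * D) / (2 * eps)) ^+ 2
    + (sigma ^+ 2 * nu ^+ 2 + 4 * sigma * kf * D) + d * D ^+ 2 <=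
  (4 * kf * D / eps + D ^+ 2 / eps + sigma * (nu ^+ 2 / eps - nu)
   + 2 * d * (2 * nu + eps / 2 + l)) ^+ 2.
Proof.
move=> kf0 D0 eps0 epsnu sigma0 sigma1 d1 l0.
have nu0 : 0 < nu by apply: lt_le_trans epsnu.
have [d0 e0] : 0 < d /\ eps != 0 by split; [lra|rewrite gt_eqF].
set k0 := 4 * kf * D / eps; set k1 := D ^+ 2 / eps.
set k2 := nu ^+ 2 / eps - nu.
have k00 : 0 < k0 by rewrite divr_gt0// !mulr_gt0.
have k10 : 0 < k1 by rewrite divr_gt0// exprn_gt0.
have k20 : 0 <= k2.
  by rewrite subr_ge0 ler_pdivlMr// expr2 ler_wpM2l// ltW.
have -> : (sigma * nu ^+ 2 + 4 * kf * D) / (2 * eps) =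
    k0 / 2 + sigma * k2 / 2 + sigma * nu / 2 by rewrite /k0 /k2; field.
have -> : 4 * sigma * kf * D = k0 * (sigma * eps) by rewrite /k0; field.
have -> : d * D ^+ 2 = k1 * (d * eps) by rewrite /k1; field.
set B := (X in _ <= X ^+ 2).
have sd : sigma <= d by lra.
have sn : sigma * nu <= d * nu by rewrite ler_wpM2r// ltW.
have se : sigma * eps <= d * eps by rewrite ler_wpM2r// ltW.
have dl : 0 <= d * l by rewrite mulr_ge0// ltW.
have dn : 0 < sigma * nu by rewrite mulr_gt0.
have sk2 : 0 <= sigma * k2 by rewrite mulr_ge0// ltW.
have seps : 0 < sigma * eps by rewrite mulr_gt0.
pose v := k0 / 2 + sigma * k2 / 2 + sigma * nu / 2.
pose m := (k1 + d * eps) / 2.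
pose q := (k0 + sigma * eps) / 2.
have sumB : v + m + sigma * nu + q <= B by rewrite /B /v /m /q; lra.
have v0 : 0 <= v by rewrite /v; lra.
have m0 : 0 <= m by rewrite /m; lra.
have q0 : 0 <= q by rewrite /q; lra.
have qq : k0 * (sigma * eps) <= q ^+ 2.
  by have := sqr_ge0 (k0 - sigma * eps); rewrite /q; lra.
have mm : k1 * (d * eps) <= m ^+ 2.
  by have := sqr_ge0 (k1 - d * eps); rewrite /m; lra.
apply: (@le_trans _ _ ((v + m + sigma * nu + q) ^+ 2)); last first.
  by rewrite ler_pXn2r// nnegrE; lra.
have vm := mulr_ge0 v0 m0; have vn := mulr_ge0 v0 (ltW dn).
have vq := mulr_ge0 v0 q0; have mn := mulr_ge0 m0 (ltW dn).
have mq := mulr_ge0 m0 q0; have nq := mulr_ge0 (ltW dn) q0.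
rewrite -/v; clearbody v m q.
lra.
Qed.

End DualBound.

(** * Closing arithmetic and delayed indices *)

(** Here [q], [S], [P] are the square roots of [tau + 1], [T], [p], so [sigma = q / S], and [k01] is
    [k0 + k1]. The difference of the two sides is an explicit sum of nonnegative monomials. *)
Lemma total_bound_arith (R : realType) (q S P kf kg nu k01 k2 k3 : R) :
  0 < q -> 0 < S -> 0 <= P -> 0 <= kf -> 0 <= kg ->
  0 <= nu + k2 -> 0 <= k01 -> 0 <= k3 ->
  (k01 + q / S * k2 + 2 * q ^+ 2 * k3) / (q / S)
    + S ^+ 2 * (kg * (q / S * (kf + P * kg *
        (k01 + q / S * k2 + 2 * q ^+ 2 * k3 + q / S * nu)))) <=
  (k2 + 2 * P * kg ^+ 2 * (nu + k2) * q ^+ 2) + k01 * q^-1 * S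
    + (2 * k3 + 2 * kg * kf + 2 * P * kg ^+ 2 * k01) * q * S
    + 4 * P * kg ^+ 2 * k3 * q ^+ 3 * S.
Proof.
move=> q0 S0 P0 kf0 kg0 nuk k010 k30; rewrite -subr_ge0.
rewrite (_ : _ - _ = kg * kf * q * S + P * kg ^+ 2 * k01 * q * S
  + P * kg ^+ 2 * (nu + k2) * q ^+ 2 + 2 * P * kg ^+ 2 * k3 * q ^+ 3 * S);
  last first.
  by field; rewrite !gt_eqF.
by rewrite !addr_ge0// !mulr_ge0// ?exprn_ge0// ltW.
Qed.

(** Separates the initial block, fixed by convention, from the iterates computed with the feedback
    of a round [s]. *)
Lemma delayed_indexP (tau T t : nat) : (t <= tau + T)%N ->
  (t <= tau)%N \/ exists2 s, (s < T)%N & t = (tau + s).+1.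
Proof.
move=> tT; have [ttau|taut] := leqP t tau; [by left|right].
by exists (t - tau.+1)%N; lia.
Qed.

(** * Cumulative constraint violation of the delayed algorithm *)

Theorem theorem3 (R : realType) (X : finNormedModType R)
    (dot : {dot X for idfun}) (hdot : induces_norm dot)
    (C U : set X) (hCclosed : closed C) (hCconvex : @convex_set R X C)
    (hU : is_domain C U)
    (T p tau : nat) (hT1 : (1 <= T)%N) (hp : (1 <= p)%N) (hTtau : (tau < T)%N)
    (f : nat -> X -> R) (g : nat -> X -> 'rV[R]_p)
    (F : nat -> X -> X -> R) (G : nat -> X -> X -> 'rV[R]_p)
    (D kf kg eps0 nug : R)
    (hFG : are_models C U T F G)
    (h1 : assumption1 C D)
    (h2 : assumption2 dot C U T f g kf kg)
    (h3 : assumption3 C T g eps0)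
    (h4 : assumption4 C U T f g F G nug)
    (sigma alpha : R)
    (halpha : alpha = Num.sqrt (T%:R / (tau%:R + 1)))
    (hsigma : sigma = Num.sqrt ((tau%:R + 1) / T%:R))
    (x : nat -> X) (lam : nat -> 'rV[R]_p)
    (hx : algorithm2 C T tau F G sigma alpha x lam)
    (hT : (tau%:R + 1) * p%:R * kg ^+ 2 < T%:R)
    (i : 'I_p) :
  let k0 := 4 * kf * D / eps0 in
  let k1 := D ^+ 2 / eps0 in
  let k2 := nug ^+ 2 / eps0 - nug in
  let k3 := 2 * nug + eps0 / 2
            + 8 * nug ^+ 2 / eps0 * ln (32 * nug ^+ 2 / eps0 ^+ 2) in
  let d : R := tau%:R + 1 in
  let sqrtp : R := Num.sqrt p%:R in
  let sqrtT : R := Num.sqrt T%:R in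
  \sum_(0 <= t < T) g t (x t) 0 i <=
    (k2 + 2 * sqrtp * kg ^+ 2 * (nug + k2) * d)
    + (k0 + k1) * d `^ (- (1 / 2)) * sqrtT
    + (2 * k3 + 2 * kg * kf + 2 * sqrtp * kg ^+ 2 * (k0 + k1))
      * d `^ (1 / 2) * sqrtT
    + 4 * sqrtp * kg ^+ 2 * k3 * d `^ (3 / 2) * sqrtT.
Proof.
cbv zeta.
set k0 := 4 * kf * D / eps0; set k1 := D ^+ 2 / eps0.
set k2 := nug ^+ 2 / eps0 - nug; set k3 := 2 * nug + _ + _.
set d : R := tau%:R + 1; set sqrtp := Num.sqrt p%:R; set sqrtT := Num.sqrt T%:R.
have [CU _ _] := hU; have [D0 CD] := h1; have [kf0 kg0 hf hg] := h2.
have [eps00 [xh Cxh slater]] := h3; have [nug0 hmod] := h4.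
have [Cx0 xdelay lamdelay hstep] := hx.
have TR0 : 0 < T%:R :> R by rewrite ltr0n.
have d0 : 0 < d by rewrite ltr_wpDl.
have d1 : 1 <= d by rewrite lerDr.
pose q := Num.sqrt d; have q0 : 0 < q by rewrite sqrtr_gt0.
have S0 : 0 < sqrtT by rewrite sqrtr_gt0.
have q2 : q ^+ 2 = d by rewrite sqr_sqrtr// ltW.
have S2 : sqrtT ^+ 2 = T%:R by rewrite sqr_sqrtr// ltW.
have sigmaE : sigma = q / sqrtT.
  by rewrite hsigma -/d sqrtrM ?ltW// sqrtrV// ltW.
have alphaE : alpha = sqrtT / q.
  by rewrite halpha -/d sqrtrM ?ltW// sqrtrV// ltW.
have sigma0 : 0 < sigma by rewrite sigmaE divr_gt0.
have sigma1 : sigma <= 1.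
  rewrite sigmaE ler_pdivrMr// mul1r ler_wsqrtr//.
  by rewrite /d natr1 ler_nat.
have alpha_sigma : alpha * sigma = 1.
  by rewrite alphaE sigmaE; field; rewrite !gt_eqF.
have step s : (s < T)%N ->
    is_argmin C (fun y => aug_lagrangian F G s (x s) sigma y (lam (tau + s)%N)
                          + alpha / 2 * `|y - x s| ^+ 2) (x (tau + s).+1) /\
    lam (tau + s).+1 =
      pospart (lam (tau + s)%N + sigma *: G s (x s) (x (tau + s).+1)).
  move=> sT; have := hstep (tau + s)%N; rewrite leq_addr ltn_add2l sT.
  by rewrite /= addKn; apply.
have Cx t : (t <= tau + T)%N -> C (x t).
  move=> /delayed_indexP[/xdelay -> //|[s sT ->]].
  by have [[]] := step s sT.
have lam_ge0 t j : (t <= tau + T)%N -> 0 <= lam t 0 j.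
  move=> /delayed_indexP[/lamdelay ->|[s sT ->]]; first by rewrite mxE.
  by have [_ ->] := step s sT; exact: pospart_ge0.
have Cxs s : (s < T)%N -> C (x s).
  by move=> sT; apply: Cx; rewrite ltnW// ltn_addl.
have Cxs1 s : (s < T)%N -> C (x (tau + s).+1).
  by move=> sT; apply: Cx; rewrite ltn_add2l.
(* At the Slater point the entry [i] of the model is at most [- eps0], while its absolute value is
   at most [nug]. *)
have epsnug : eps0 <= nug.
  have [_ mG Gnu] := hmod 0%N (x 0%N) hT1 Cx0.
  rewrite (le_trans _ (Gnu xh Cxh))// (le_trans _ (ler_norm2_entry _ i))//.
  rewrite -normrN (le_trans _ (ler_norm _))// lerNr.
  by rewrite (le_trans ((mG i).1 xh (CU _ Cxh)))// slater.
have Flip s y : (s < T)%N -> C y ->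
    F s (x s) (x s) <= F s (x s) y + kf * `|y - x s|.
  move=> sT Cy; have [[mF Fx] _ _] := hmod s (x s) sT (Cxs s sT).
  have [fc _ fk] := hf s sT; have [cF _] := hFG s (x s) sT (Cxs s sT).
  exact: (lower_model_lipschitz hdot hCclosed hU CD fc fk cF mF
    (Cxs s sT) Cy Fx).
have Glip s j y : (s < T)%N -> C y ->
    G s (x s) (x s) 0 j <= G s (x s) y 0 j + kg * `|y - x s|.
  move=> sT Cy; have [_ /(_ j)[mG Gx] _] := hmod s (x s) sT (Cxs s sT).
  have [gc _ gk] := hg s j sT; have [_ /(_ j) cG] := hFG s (x s) sT (Cxs s sT).
  exact: (lower_model_lipschitz hdot hCclosed hU CD gc gk cG mG
    (Cxs s sT) Cy Gx).
have flip s y z : (s < T)%N -> C y -> C z -> f s y <= f s z + kf * `|z - y|.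
  move=> sT Cy Cz; have [fc cf fk] := hf s sT.
  exact: (lower_model_lipschitz hdot hCclosed hU CD fc fk cf _ Cy Cz).
have convF s : (s < T)%N -> @convex_function R X C (F s (x s)).
  move=> sT; have [cF _] := hFG s (x s) sT (Cxs s sT).
  exact: convex_functionS CU cF.
have convG s j : (s < T)%N -> @convex_function R X C (fun y => G s (x s) y 0 j).
  move=> sT; have [_ /(_ j) cG] := hFG s (x s) sT (Cxs s sT).
  exact: convex_functionS CU cG.
have Gnu s y : (s < T)%N -> C y -> norm2 (G s (x s) y) <= nug.
  by move=> sT Cy; have [_ _] := hmod s (x s) sT (Cxs s sT); apply.
(* The distances in the drift are [tau + 1] indices apart. Summing over a window of that length
   makes their difference equal to [S s - S s.+1]. *)
pose S s := \sum_(j < tau.+1) `|xh - x (tau + s - j)%N| ^+ 2.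
(* The level at which the decrease [2 sigma eps0 theta] balances the constant term of the drift. *)
pose theta := (sigma * nug ^+ 2 + 4 * kf * D) / (2 * eps0).
have drift s : (s < T)%N ->
    norm2 (lam (tau + s.+1)%N) ^+ 2 + S s.+1 <=
    norm2 (lam (tau + s)%N) ^+ 2 + S s
    - 2 * sigma * eps0 * norm2 (lam (tau + s)%N)
    + (sigma ^+ 2 * nug ^+ 2 + 4 * sigma * kf * D).
  move=> sT; have [xmin lamS] := step s sT.
  have sTle : (tau + s <= tau + T)%N by rewrite leq_add2l ltnW.
  have Gxh j : G s (x s) xh 0 j <= - eps0.
    have [_ /(_ j)[mG _] _] := hmod s (x s) sT (Cxs s sT).
    by rewrite (le_trans (mG xh (CU _ Cxh)))// slater.
  have := dual_drift hdot hCconvex (convF s sT) (fun j => convG s j sT) sigma0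
    alpha_sigma (fun j => lam_ge0 _ j sTle) xmin Cxh (ltW eps00) Gxh
    (Gnu s xh sT Cxh).
  rewrite -lamS -addnS.
  have -> : S s.+1 = S s + `|xh - x (tau + s.+1)%N| ^+ 2 - `|xh - x s| ^+ 2.
    rewrite /S big_ord_recl subn0 [in RHS]big_ord_recr/= addKn.
    under eq_bigr do rewrite /bump/= add1n addnS subSS.
    by ring.
  (* Going from [xh] to [x s] through [f], then from [x s] to the new iterate through the model,
     costs [kf D] each time. *)
  have FF : F s (x s) xh - F s (x s) (x (tau + s.+1)%N) <= 2 * kf * D.
    have [[mF Fx] _ _] := hmod s (x s) sT (Cxs s sT).
    have := mF xh (CU _ Cxh); have := Flip s _ sT (Cxs1 s sT).
    have := flip s xh (x s) sT Cxh (Cxs s sT).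
    have := ler_wpM2l (ltW kf0) (CD _ _ (Cxs1 s sT) (Cxs s sT)).
    have := ler_wpM2l (ltW kf0) (CD _ _ (Cxs s sT) Cxh).
    by rewrite Fx addnS; lra.
  by have := ler_wpM2l (ltW sigma0) FF; lra.
(* The logarithm is nonnegative because [eps0 <= nug]. *)
have k3E : 0 <= 8 * nug ^+ 2 / eps0 * ln (32 * nug ^+ 2 / eps0 ^+ 2).
  rewrite mulr_ge0//; first by rewrite divr_ge0 ?mulr_ge0 ?sqr_ge0// ltW.
  rewrite ln_ge0// ler_pdivlMr ?exprn_gt0// mul1r.
  have : eps0 ^+ 2 <= nug ^+ 2 by rewrite ler_pXn2r// nnegrE ltW.
  by have := sqr_ge0 nug; lra.
have kfD : 0 <= kf * D by rewrite mulr_ge0// ltW.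
pose B := k0 + k1 + sigma * k2 + 2 * d * k3.
have k00 : 0 <= k0 by rewrite divr_ge0 ?(ltW eps00)//; lra.
have k10 : 0 <= k1 by rewrite divr_ge0 ?sqr_ge0 ?(ltW eps00).
have nuk2 : 0 <= nug + k2 by rewrite /k2 subrKC divr_ge0 ?sqr_ge0 ?(ltW eps00).
have k20 : 0 <= k2.
  by rewrite subr_ge0 ler_pdivlMr// expr2 ler_wpM2l// ltW.
have k30 : 0 <= k3 by rewrite /k3; lra.
have B0 : 0 <= B.
  by rewrite !addr_ge0// ?mulr_ge0// ?ltW.
have lamB s : (s <= T)%N -> norm2 (lam (tau + s)%N) <= B.
  move=> sT; rewrite -(ler_pXn2r (n := 2))// ?nnegrE ?norm2_ge0//.
  apply: le_trans (dual_bound_arith kf0 D0 eps00 epsnug sigma0 sigma1 d1 k3E).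
  have b0 : 0 <= sigma ^+ 2 * nug ^+ 2 + 4 * sigma * kf * D.
    have := mulr_ge0 (sqr_ge0 sigma) (sqr_ge0 nug).
    by have := mulr_ge0 (ltW sigma0) kfD; lra.
  apply: (@drift_bounded R (fun s => norm2 (lam (tau + s)%N)) S
    (2 * sigma * eps0) _ _ theta T) => //.
  - rewrite divr_ge0//; last by rewrite mulr_ge0// ltW.
    by have := mulr_ge0 (ltW sigma0) (sqr_ge0 nug); lra.
  - by rewrite mulr_ge0 ?sqr_ge0// ltW.
  - have -> // : 2 * sigma * eps0 * theta =
        sigma ^+ 2 * nug ^+ 2 + 4 * sigma * kf * D.
    by rewrite /theta; field; rewrite gt_eqF.
  - by rewrite !mulr_ge0// ltW.
  - by move=> t _; exact: norm2_ge0.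
  - move=> t tT; rewrite /S sumr_ge0/= => [|j _]; last exact: sqr_ge0.
    have -> : d * D ^+ 2 = \sum_(j < tau.+1) D ^+ 2.
      by rewrite sumr_const card_ord -mulr_natl /d natr1.
    apply: ler_sum => j _; rewrite ler_pXn2r ?nnegrE ?(ltW D0)//.
    apply: CD => //; apply: Cx; rewrite (leq_trans (leq_subr _ _))//.
    by rewrite leq_add2l.
  - rewrite addn0 lamdelay// /norm2 big1 ?sqrtr0// => j _.
    by rewrite mxE expr0n.
have stepB s : (s < T)%N -> `|x (tau + s).+1 - x s| <=
    sigma * (kf + sqrtp * kg * (B + sigma * nug)).
  move=> sT; have [xmin _] := step s sT.
  have sTle : (tau + s <= tau + T)%N by rewrite leq_add2l ltnW.
  have := step_length hdot hCconvex (convF s sT) (fun j => convG s j sT) sigma0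
    alpha_sigma (fun j => lam_ge0 _ j sTle) xmin (Cxs s sT) (ltW kf0) (ltW kg0)
    (Gnu s _ sT (Cxs s sT)) (Flip s _ sT (Cxs1 s sT))
    (fun j => Glip s j _ sT (Cxs1 s sT)).
  move=> /le_trans; apply; rewrite ler_wpM2l ?(ltW sigma0)// lerD2l.
  by rewrite ler_wpM2l ?mulr_ge0 ?sqrtr_ge0 ?(ltW kg0)// lerD2r lamB// ltnW.
set c := sigma * _ in stepB.
have round s : (s < T)%N -> g s (x s) 0 i <=
    (lam (tau + s.+1)%N 0 i - lam (tau + s)%N 0 i) / sigma + kg * c.
  move=> sT; have [_ lamS] := step s sT.
  have [_ /(_ i)[_ Gx] _] := hmod s (x s) sT (Cxs s sT).
  rewrite -Gx (le_trans (Glip s i _ sT (Cxs1 s sT)))// lerD//.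
    rewrite ler_pdivlMr// addnS lamS !mxE lerBrDl mulrC le_max.
    by rewrite lexx.
  by rewrite ler_wpM2l ?(ltW kg0)// stepB.
apply: (@le_trans _ _ (B / sigma + T%:R * (kg * c))).
  rewrite big_mkord.
  apply: (@le_trans _ _ (\sum_(s < T)
    ((lam (tau + s.+1)%N 0 i - lam (tau + s)%N 0 i) / sigma + kg * c))).
    by apply: ler_sum => s _; exact: round.
  rewrite big_split/= sumr_const card_ord mulr_natl lerD2r -mulr_suml.
  rewrite ler_wpM2r ?invr_ge0 ?(ltW sigma0)//.
  rewrite -(big_mkord xpredT
    (fun s => lam (tau + s.+1)%N 0 i - lam (tau + s)%N 0 i)).
  (* The telescoped sum starts at [lam tau = 0], so only the last multiplier remains, bounded by
     [B]. *)
  rewrite (telescope_sumr (fun s => lam (tau + s)%N 0 i))// addn0.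
  rewrite (lamdelay tau)// mxE subr0.
  by rewrite (le_trans (ler_norm _))// (le_trans (ler_norm2_entry _ _))// lamB.
(* The half-integer powers of [d] become integer powers of its square root [q]. *)
have dq a : d `^ a = q `^ (2 * a).
  by rewrite -q2 -powR_mulrn ?ltW// -powRrM.
rewrite !dq (_ : 2 * - (1 / 2) = -1)//; last by field.
rewrite (_ : 2 * (1 / 2) = 1)//; last by field.
rewrite (_ : 2 * (3 / 2) = 3%:R)//; last by field.
have q0' := ltW q0; rewrite powRr1// powR_inv1// powR_mulrn//.
rewrite /c /B -S2 -q2 sigmaE.
apply: total_bound_arith => //.
- exact: sqrtr_ge0.
- exact: ltW.
- exact: ltW.
- exact: addr_ge0.
Qed.
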